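(* Let $G$ be a finite, loopless undirected graph (multiple edges allowed). Let $\Gamma$ be a finite group and $\pi:\Gamma\to\mathrm{GL}_d(\mathbb{C})$ a representation such that the group $\pi(\Gamma)$ is generated by pseudo-reflections. Then: (1) $\mathbb{E}_\gamma[\phi_{\gamma,\pi}(x)]$ is real rooted, where $\gamma$ is a uniformly random $\Gamma$-labeling of $G$ and $\phi_{\gamma,\pi}$ is the characteristic polynomial of the $(\Gamma,\pi)$-covering $A_{\gamma,\pi}$ of $G$. (2) There exists a $(\Gamma,\pi)$-covering $A_{\gamma,\pi}$ of $G$ whose largest eigenvalue is at most the largest root of $\mathbb{E}_\gamma[\phi_{\gamma,\pi}(x)]$.
   Context: A matrix $A\in\mathrm{GL}_d(\mathbb{C})$ is a pseudo-reflection if it has finite order and $\mathrm{rank}(A-I)=1$. Orient each edge of $G$ arbitrarily; $E^+(G)$ is the resulting set of oriented edges, $E^-(G)$ the set of their reverses, $E(G)=E^+(G)\sqcup E^-(G)$, $-e$ is the reverse of $e$, and $h(e),t(e)$ are the head and tail of $e$. A $\Gamma$-labeling of $G$ is a function $\gamma:E(G)\to\Gamma$ with $\gamma(-e)=\gamma(e)^{-1}$; the labelings are given the uniform distribution. With $n=|V(G)|$, $A_{\gamma,\pi}$ is the $nd\times nd$ matrix made of $d\times d$ blocks indexed by pairs $(u,v)\in V(G)^2$, where the $(u,v)$ block is $\sum_{e\in E(G):\,t(e)=u,\,h(e)=v}\pi(\gamma(e))$ (zero if there are no such edges). It is called a $(\Gamma,\pi)$-covering of $G$; its eigenvalues are all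 real because $\pi$ is conjugate to a unitary representation. Its characteristic polynomial is $\phi_{\gamma,\pi}(x)=\det(xI-A_{\gamma,\pi})$. *)

(* Defs.v *)
From HB Require Import structures.
From mathcomp Require Import all_boot all_order all_algebra all_fingroup all_character.
From mathcomp Require Import reals.
From mathcomp Require Import complex.

Set Implicit Arguments.
Unset Strict Implicit.
Unset Printing Implicit Defensive.

Import Order.TTheory GRing.Theory Num.Theory.

Local Open Scope ring_scope.
Local Open Scope complex_scope.

(* Finite loopless undirected multigraphs: distinct edges may have the same
   ends, and loops are excluded because every edge has two distinct ends. *)
Record multigraph := Multigraph {
  vertex : finType;
  edge : finType;
  ends : edge -> {set vertex};
  card_ends : forall e, #|ends e| = 2
}.

Record orientation (G : multigraph) := Orientation {
  tail0 : edge G -> vertex G;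
  head0 : edge G -> vertex G;
  ends_orientation : forall e, ends e = [set tail0 e; head0 e]
}.

(* E(G) = E^+(G) + E^-(G): [inl e] is e with its chosen orientation, and
   [inr e] is its reverse. *)
Definition dart (G : multigraph) : finType := (edge G + edge G)%type.

Section Darts.
Variables (G : multigraph) (o : orientation G).

Definition dart_rev (a : dart G) : dart G :=
  match a with inl e => inr e | inr e => inl e end.

Definition tail (a : dart G) : vertex G :=
  match a with inl e => tail0 o e | inr e => head0 o e end.

Definition head (a : dart G) : vertex G :=
  match a with inl e => head0 o e | inr e => tail0 o e end.

End Darts.

Definition labelings (G : multigraph) (gT : finGroupType) :
    {set {ffun dart G -> gT}} :=
  [set gam : {ffun dart G -> gT} |
    [forall a, gam (dart_rev a) == (gam a)^-1%g]].

Section Covering.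
Variables (R : realType) (G : multigraph) (o : orientation G).
Variables (gT : finGroupType) (d : nat).
Variable rG : mx_representation R[i] [set: gT] d.

(* The dimension [\sum_(u < #|vertex G|) d] is n * d; blocks are indexed by
   vertices through [enum_val]. *)
Definition covering (gam : {ffun dart G -> gT}) :
    'M[R[i]]_(\sum_(u < #|vertex G|) d) :=
  \mxblock_(u < #|vertex G|, v < #|vertex G|)
    \sum_(a : dart G | (tail o a == enum_val u) && (head o a == enum_val v))
      rG (gam a).

Definition expected_char_poly : {poly R[i]} :=
  #|labelings G gT|%:R^-1 *:
    \sum_(gam in labelings G gT) char_poly (covering gam).

End Covering.

Section Reflections.
Variables (R : realType) (d : nat).

Definition pseudo_reflection (A : 'M[R[i]]_d) : Prop :=
  [/\ A \in unitmx,
      exists2 k : nat, (0 < k)%N & A ^+ k = 1%:M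
    & \rank (A - 1%:M) = 1%N].

(* The subgroup of GL_d generated by S, for S a set of invertible matrices. *)
Inductive generated (S : 'M[R[i]]_d -> Prop) : 'M[R[i]]_d -> Prop :=
| generated_in A : S A -> generated S A
| generated1 : generated S 1%:M
| generatedM A B : generated S A -> generated S B -> generated S (A *m B)
| generatedV A : generated S A -> generated S (invmx A).

Definition generated_by_pseudo_reflections (H : 'M[R[i]]_d -> Prop) : Prop :=
  exists2 S : 'M[R[i]]_d -> Prop,
    forall A, S A -> pseudo_reflection A & forall A, H A <-> generated S A.

End Reflections.

Definition real_rooted (R : realType) (p : {poly R[i]}) : Prop :=
  p != 0 /\ forall z : R[i], root p z -> z \is Num.real.

(* In the partial order of R[i], z <= r%:C means that z is real and its real
   part is at most r; so all complex numbers in P are real and at most r. *)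
Definition is_largest (R : realType) (P : pred R[i]) (r : R) : Prop :=
  P r%:C /\ forall z : R[i], P z -> z <= r%:C.

(* Main.v *)
(* Up to a positive definite invariant form J, the covering with labels k is the
   Hermitian form L^* V(k)^* B V(k) L, where B and L are fixed and k -> V(k) is a
   representation of the group of all labelings, which is generated by elements t
   with rank (V(t) - 1) <= 1. For such t, V(t)^* B V(t) = B + u^* u - v^* v.

   Fix x in the upper half-plane. The determinant det (x - J^-1 L^* B L) is affine
   along every line B + s w^* w, does not vanish for Hermitian B, and turns
   counterclockwise when w^* w is added. All three properties survive the
   replacement of F(B) by p F(B) + q F(V(t)^* B V(t)): nonvanishing because both
   values have argument at least that of h = F(B - v^* v), with equality only when
   they equal h, and the direction of rotation because it is a quadratic form in
   (p, q), nonnegative on both axes, whose isotropic vectors can be controlled by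
   nonvanishing. Hence the expected characteristic polynomial over any lazy random
   walk with steps t is real rooted. Such walks equidistribute, and a lower bound
   |p(z)| >= |Im z|^n for real rooted monic p passes to the limit.

   For the largest root, all roots of a monic real rooted p are below c exactly when
   all coefficients of p(X + c) are positive. If this holds for a point of a segment
   of monic real rooted polynomials, it holds for one of its ends; so it can be
   propagated from the mean, through a sufficiently long walk, to a single
   labeling. *)
Require Import Defs.
From mathcomp Require Import all_boot all_order all_algebra all_fingroup all_character.
From mathcomp Require Import reals complex.
From mathcomp Require Import ring.

Import Order.TTheory GRing.Theory Num.Theory.
Local Open Scope ring_scope.

Set Implicit Arguments.
Unset Strict Implicit.
Unset Printing Implicit Defensive.

Local Notation "A ^h" := (map_mx Num.conj A^T) (at level 8, format "A ^h").

(** * Rank-one perturbations of Hermitian forms *)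

Section HermitianForms.
Variable C : numClosedFieldType.
Implicit Types m n p : nat.

Lemma ctmxK m n (A : 'M[C]_(m, n)) : (A^h)^h = A.
Proof. by apply/matrixP => i j; rewrite !mxE conjCK. Qed.

Lemma ctmxM m n p (A : 'M[C]_(m, n)) (B : 'M_(n, p)) :
  (A *m B)^h = B^h *m A^h.
Proof. by rewrite trmx_mul map_mxM. Qed.

Lemma ctmxD m n (A B : 'M[C]_(m, n)) : (A + B)^h = A^h + B^h.
Proof. by rewrite linearD map_mxD. Qed.

Lemma ctmxN m n (A : 'M[C]_(m, n)) : (- A)^h = - A^h.
Proof. by rewrite linearN map_mxN. Qed.

Lemma ctmxZ m n (a : C) (A : 'M[C]_(m, n)) :
  (a *: A)^h = a^* *: A^h.
Proof. by rewrite linearZ map_mxZ. Qed.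

Lemma ctmx_scalar n (a : C) : (a%:M : 'M_n)^h = (a^*)%:M.
Proof. by rewrite tr_scalar_mx map_scalar_mx. Qed.

Lemma ctmx_sum m n (I : finType) (F : I -> 'M[C]_(m, n)) :
  (\sum_i F i)^h = \sum_i (F i)^h.
Proof. by rewrite linear_sum -map_mx_sum. Qed.

Definition selfadjoint n (B : 'M[C]_n) := B^h = B.

Definition posdef n (J : 'M[C]_n) :=
  selfadjoint J /\ forall v : 'rV_n, v != 0 -> 0 < (v *m J *m v^h) 0 0.

Lemma selfadjoint_congr m n (V : 'M[C]_(m, n)) B :
  selfadjoint B -> selfadjoint (V^h *m B *m V).
Proof. by move=> hB; rewrite /selfadjoint !ctmxM ctmxK hB mulmxA. Qed.

Lemma selfadjoint_rank1 n (w : 'rV[C]_n) : selfadjoint (w^h *m w).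
Proof. by rewrite /selfadjoint ctmxM ctmxK. Qed.

Lemma selfadjointD n (A B : 'M[C]_n) :
  selfadjoint A -> selfadjoint B -> selfadjoint (A + B).
Proof. by rewrite /selfadjoint ctmxD => -> ->. Qed.

Lemma selfadjointN n (A : 'M[C]_n) : selfadjoint A -> selfadjoint (- A).
Proof. by rewrite /selfadjoint ctmxN => ->. Qed.

Lemma selfadjointZ n (a : C) (A : 'M[C]_n) :
  a \is Num.real -> selfadjoint A -> selfadjoint (a *: A).
Proof. by rewrite /selfadjoint ctmxZ => /CrealP -> ->. Qed.

Lemma form_sqr_ge0 n (v : 'rV[C]_n) : 0 <= (v *m v^h) 0 0.
Proof.
rewrite mxE; apply: sumr_ge0 => j _; rewrite !mxE; exact: mul_conjC_ge0.
Qed.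

Lemma form_sqr_gt0 n (v : 'rV[C]_n) : v != 0 -> 0 < (v *m v^h) 0 0.
Proof.
move=> v0; rewrite lt_neqAle form_sqr_ge0 andbT eq_sym.
apply: contra v0 => /eqP; rewrite mxE => h.
apply/eqP/rowP => j; rewrite [RHS]mxE.
have := h => /eqP; rewrite psumr_eq0; last by move=> k _; rewrite !mxE mul_conjC_ge0.
move=> /allP /(_ j); rewrite mem_index_enum => /(_ isT) /=.
by rewrite !mxE mul_conjC_eq0 => /eqP.
Qed.

Lemma form_real m (B : 'M[C]_m) (v : 'rV_m) :
  selfadjoint B -> (v *m B *m v^h) 0 0 \is Num.real.
Proof.
move=> hB; apply/CrealP; have : ((v *m B *m v^h)^h) 0 0 = (v *m B *m v^h) 0 0.
  by rewrite !ctmxM ctmxK hB mulmxA.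
by rewrite !mxE.
Qed.

Lemma posdef_unit n (J : 'M[C]_n) : posdef J -> J \in unitmx.
Proof.
move=> [_ hJ]; rewrite unitmxE unitfE; apply/det0P => -[v v0 vJ].
by have := hJ v v0; rewrite vJ mul0mx mxE ltxx.
Qed.

Lemma det_rank1 n (Y : 'M[C]_n) (c : 'cV_n) (r : 'rV_n) (s : C) :
  \det (Y + s *: (c *m r)) = \det Y + s * (\det (Y + c *m r) - \det Y).
Proof.
pose E r' : 'M_(n + 1) := block_mx Y (- c) r' 1%:M.
have detE r' : \det (Y + c *m r') = \det (E r').
  have -> : E r' = block_mx (Y + c *m r') (- c) 0 1%:M
                   *m block_mx 1%:M 0 r' 1%:M.
    by rewrite mulmx_block !mulmx1 !mul0mx !mulmx0 !mul1mx !add0r mulNmx addrK.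
  by rewrite det_mulmx det_ublock det_lblock !det1 !mulr1.
have detE0 : \det Y = \det (E 0) by rewrite -detE mulmx0 addr0.
have row'E r' r'' : row' (rshift n ord0) (E r') = row' (rshift n ord0) (E r'').
  by rewrite /E /block_mx !row'Kd; congr castmx; congr col_mx; apply/matrixP => -[].
have rowE r' : row (rshift n ord0) (E r') = row_mx r' 1%:M.
  by rewrite /E rowKd row_id.
rewrite scalemxAr !detE detE0.
rewrite (@determinant_multilinear _ _ (E (s *: r)) (E r) (E 0) (rshift n ord0) s (1 - s)).
- by ring.
- by rewrite !rowE !scale_row_mx scaler0 add_row_mx addr0 -scalerDl subrKC scale1r.
- exact: row'E.
- exact: row'E.
Qed.

Lemma posdef_nonsingular m n (J : 'M[C]_n) (B : 'M_m) (L : 'M_(m, n))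
    (w : 'rV_m) (x y : C) :
  posdef J -> selfadjoint B -> 0 < 'Im x -> 'Im y <= 0 ->
  \det (x%:M - invmx J *m (L^h *m (B + y *: (w^h *m w)) *m L)) != 0.
Proof.
move=> pJ hB x0 y0; apply/det0P => -[v v0 /eqP].
rewrite mulmxBr subr_eq0 mul_mx_scalar mulmxA => /eqP.
set v' := v *m invmx J; have J1 := posdef_unit pJ.
have -> : v = v' *m J by rewrite mulmxKV.
have v'0 : v' != 0.
  by apply: contra v0 => /eqP e; rewrite -(mulmxKV J1 v) -/v' e mul0mx.
move=> /(congr1 (fun u => (u *m v'^h) 0 0)).
have c0 := proj2 pJ v' v'0.
have -> : (x *: (v' *m J) *m v'^h) 0 0 = x * (v' *m J *m v'^h) 0 0.
  by rewrite -scalemxAl mxE.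
set u := v' *m L^h; set z := u *m w^h.
have -> : v' *m (L^h *m (B + y *: (w^h *m w)) *m L) *m v'^h =
   u *m B *m u^h + y *: (z *m z^h).
  rewrite /z /u !ctmxM !ctmxK mulmxDr mulmxDl mulmxDr mulmxDl -!mulmxA.
  by rewrite -scalemxAl -!scalemxAr -!mulmxA.
have -> : (u *m B *m u^h + y *: (z *m z^h)) 0 0 =
   (u *m B *m u^h) 0 0 + y * (z *m z^h) 0 0 by rewrite [LHS]mxE [X in _ + X]mxE.
move=> /(congr1 (fun z => 'Im z)).
rewrite raddfD /= (Creal_ImP _ (form_real u hB)) add0r (ImMr (ger0_real (form_sqr_ge0 z))) (ImMr (gtr0_real c0)).
move=> e; have : 'Im x * (v' *m J *m v'^h) 0 0 <= 0.
  by rewrite e mulr_le0_ge0 // form_sqr_ge0.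
by rewrite (lt_geF (mulr_gt0 x0 c0)).
Qed.

Lemma pencil_rank1 m n (P : 'M[C]_n) (Q : 'M_(n, m)) (L : 'M_(m, n)) B
    (c : 'cV_m) (r : 'rV_m) x z :
  x%:M - P *m (Q *m (B + z *: (c *m r)) *m L) =
  (x%:M - P *m (Q *m B *m L)) + z *: (- (P *m (Q *m c)) *m (r *m L)).
Proof.
rewrite mulmxDr mulmxDl mulmxDr opprD addrA; congr (_ + _).
by rewrite -scalemxAr -scalemxAl -scalemxAr -scalerN mulNmx !mulmxA.
Qed.

Lemma horner_char_poly n (A : 'M[C]_n) x :
  (char_poly A).[x] = \det (x%:M - A).
Proof.
rewrite /char_poly -horner_evalE -det_map_mx; congr (\det _).
by apply/matrixP => i j; rewrite !mxE /= horner_evalE !hornerE hornerMn hornerX.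
Qed.

(* The value of F, never 0 on Hermitian forms, turns counterclockwise when a
   nonnegative form of rank one is added. *)
Definition rotating m (F : 'M[C]_m -> C) :=
  forall B, selfadjoint B ->
    F B != 0 /\
    forall w : 'rV_m,
      (forall s, F (B + s *: (w^h *m w)) =
                 F B + s * (F (B + w^h *m w) - F B)) /\
      0 <= 'Im (F (B + w^h *m w) * (F B)^* ).

Lemma rotating_det m n (J : 'M[C]_n) (L : 'M_(m, n)) x :
  posdef J -> 0 < 'Im x ->
  rotating (fun B => \det (x%:M - invmx J *m (L^h *m B *m L))).
Proof.
move=> pJ x0 B hB.
pose F B' := \det (x%:M - invmx J *m (L^h *m B' *m L)).
have FE y (w : 'rV_m) :
    F (B + y *: (w^h *m w)) = F B + y * (F (B + w^h *m w) - F B).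
  have det_line (Y A1 Ay : 'M[C]_n) (c : 'cV_n) (r : 'rV_n) : Ay = Y + y *: (c *m r) ->
      A1 = Y + 1 *: (c *m r) -> \det Ay = \det Y + y * (\det A1 - \det Y).
    by move=> -> ->; rewrite scale1r det_rank1.
  apply: det_line; first exact: pencil_rank1.
  by rewrite -[X in B + X]scale1r; exact: pencil_rank1.
have F0 y (w : 'rV_m) : 'Im y <= 0 -> F (B + y *: (w^h *m w)) != 0.
  exact: (posdef_nonsingular L w pJ hB x0).
split; first by have := F0 0 0; rewrite scale0r addr0 raddf0 lexx; exact.
move=> w; split=> [s|]; first exact: FE.
rewrite -!/(F _).
have {F0} : forall y, 'Im y <= 0 -> F B + y * (F (B + w^h *m w) - F B) != 0.
  by move=> y y0; rewrite -FE F0.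
move: (F (B + _)) (F B) => g f ne.
rewrite real_leNgt ?Creal_Im //; apply/negP => neg.
have gf : g - f != 0.
  apply/eqP => e; move: neg; rewrite -(subrK f g) e add0r -normCK.
  by rewrite (Creal_ImP _ _) ?ltxx // rpredX // normr_real.
have : 'Im (- f / (g - f)) <= 0.
  rewrite invC_norm mulrCA.
  rewrite ImMl ?rpredV ?rpredX ?normr_real //.
  rewrite pmulr_rle0 ?invr_gt0 ?exprn_gt0 ?normr_gt0 //.
  have -> : - f * (g - f)^* = - (g * f^* )^* + `|f| ^+ 2.
    by rewrite normCK rmorphM rmorphB /= conjCK mulrBr !mulNr opprK [g^* * _]mulrC.
  rewrite raddfD /= (Creal_ImP (`|f| ^+ 2) _) ?rpredX ?normr_real // addr0.
  by rewrite raddfN /= Im_conj opprK ltW.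
by move=> /ne; rewrite divfK // subrr eqxx.
Qed.

Lemma real_rotation_trivial (f h : C) :
  (forall s, s \is Num.real -> h + s * (f - h) != 0) ->
  'Im (f * h^* ) = 0 -> f = h.
Proof.
move=> line im; apply/eqP; rewrite -subr_eq0; apply/negP => /negP fh.
have h0 : h != 0 by have := line 0 (real0 _); rewrite mul0r addr0.
have : - h / (f - h) \is Num.real.
  rewrite -realV invf_div invrN mulrN realN mulrBl divff // rpredB ?real1 //.
  rewrite invC_norm mulrCA rpredM ?rpredV ?rpredX ?normr_real //.
  exact/Creal_ImP.
by move=> /line; rewrite divfK // subrr eqxx.
Qed.

Lemma rotation_convex (p q : C) (f g h : C) :
  0 <= p -> 0 <= q -> 0 < p + q ->
  (forall s, s \is Num.real -> h + s * (f - h) != 0) ->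
  (forall s, s \is Num.real -> h + s * (g - h) != 0) ->
  0 <= 'Im (f * h^* ) -> 0 <= 'Im (g * h^* ) -> p * f + q * g != 0.
Proof.
move=> p0 q0 pq lf lg imf img; apply/eqP => e.
have f0 : f != 0 by have := lf 1 (real1 _); rewrite mul1r subrKC.
have g0 : g != 0 by have := lg 1 (real1 _); rewrite mul1r subrKC.
have [p00|p00] := eqVneq p 0.
  move: e pq => /eqP; rewrite p00 mul0r !add0r mulf_eq0 (negPf g0) orbF.
  by move=> /eqP ->; rewrite ltxx.
have [q00|q00] := eqVneq q 0.
  move: e => /eqP; rewrite q00 mul0r !addr0 mulf_eq0 (negPf f0) orbF.
  by rewrite (negPf p00).
have : 'Im ((p * f + q * g) * h^* ) = 0 by rewrite e mul0r raddf0.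
rewrite mulrDl -!mulrA raddfD /= (ImMl (ger0_real p0)) (ImMl (ger0_real q0)) => /eqP.
rewrite (paddr_eq0 (mulr_ge0 p0 imf) (mulr_ge0 q0 img)) !mulf_eq0 (negPf p00) (negPf q00) /=.
move=> /andP[/eqP fh /eqP gh].
have {}fh : f = h by apply: real_rotation_trivial.
have {}gh : g = h by apply: real_rotation_trivial.
move: e => /eqP; rewrite gh -fh -mulrDl mulf_eq0 (negPf f0) orbF.
by rewrite gt_eqF.
Qed.

Lemma rank_le1P n (A : 'M[C]_n) : (\rank A <= 1)%N ->
  exists c : 'cV_n, exists r : 'rV_n, A = c *m r.
Proof.
rewrite leq_eqVlt ltnS leqn0 mxrank_eq0 => /orP[/eqP r1|/eqP ->]; last first.
  by exists 0, 0; rewrite mulmx0.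
move: (col_base A) (row_base A) (mulmx_base A); rewrite r1 => c r e.
by exists c, r.
Qed.

Lemma congr_reflection m (V B : 'M[C]_m) :
  (\rank (V - 1%:M)%R <= 1)%N -> selfadjoint B ->
  exists u v : 'rV_m, V^h *m B *m V = B + u^h *m u - v^h *m v.
Proof.
move=> /rank_le1P[c [r Vcr]] hB.
have -> : V = 1%:M + c *m r by rewrite -Vcr subrKC.
have sqr (t : 'rV_m) k : k \is Num.real -> (r + k *: t)^h *m (r + k *: t) =
   r^h *m r + k *: (r^h *m t + t^h *m r) + k ^+ 2 *: (t^h *m t).
  move=> /CrealP kr; rewrite ctmxD ctmxZ kr mulmxDl !mulmxDr.
  by rewrite -!scalemxAl -!scalemxAr scalerA -expr2 scalerDr !addrA.
pose t := c^h *m B + (2^-1 * (c^h *m B *m c) 0 0) *: r.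
have tE : t^h = B *m c + (2^-1 * (c^h *m B *m c) 0 0) *: r^h.
  rewrite ctmxD ctmxM ctmxK hB ctmxZ; congr (_ + _ *: _).
  apply/CrealP; rewrite realM ?realV ?realn //.
  by have := form_real c^h hB; rewrite ctmxK.
have kr : (2^-1 : C) \is Num.real by rewrite realV realn.
exists (r + 2^-1 *: t), (r + (- 2^-1) *: t).
have half2 : 2^-1 + 2^-1 = 1 :> C by rewrite [RHS]splitr !mul1r.
have diff (X Y Z : 'M[C]_m) : X + 2^-1 *: Y + Z - (X - 2^-1 *: Y + Z) = Y.
  rewrite opprD addrACA subrr addr0 opprB addrC addrA subrK -scalerDl.
  by rewrite half2 scale1r.
rewrite -addrA !sqr ?realN // sqrrN scaleNr diff.
have kE : c^h *m B *m c = ((c^h *m B *m c) 0 0)%:M.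
  by apply/matrixP => i j; rewrite !ord1 [RHS]mxE mulr1n.
rewrite tE /t; move: ((c^h *m B *m c) 0 0) kE => k kE.
rewrite ctmxD ctmx_scalar rmorph1 ctmxM [r^h *m (_ + _)]mulmxDr [r^h *m (c^h *m B)]mulmxA.
rewrite [(B *m c + _) *m r]mulmxDl -scalemxAl -scalemxAr addrACA -scalerDl.
rewrite -mulrDl half2 mul1r.
have -> : k *: (r^h *m r) = r^h *m (c^h *m B *m c) *m r.
  by rewrite kE mul_mx_scalar -scalemxAl.
rewrite mulmxDr !mulmxDl !mul1mx !mulmx1 !mulmxA -!addrA; congr (_ + _).
Qed.

Lemma indefinite_quadratic (a b c t u : C) :
  0 <= a -> b \is Num.real -> 0 <= c -> 0 <= t -> 0 <= u ->
  a * t ^+ 2 + b * (t * u) + c * u ^+ 2 < 0 -> b < 0 /\ 4 * (a * c) < b ^+ 2.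
Proof.
move=> a0 br c0 t0 u0 neg.
have tu0 : 0 <= t * u by rewrite mulr_ge0.
have X0 : 0 <= a * t ^+ 2 + c * u ^+ 2 by rewrite addr_ge0 ?mulr_ge0 ?exprn_ge0.
have XY : a * t ^+ 2 + c * u ^+ 2 < - b * (t * u).
  by rewrite -subr_lt0 (_ : _ - _ = a * t ^+ 2 + b * (t * u) + c * u ^+ 2) //; ring.
have btu : 0 < - b * (t * u) by apply: le_lt_trans XY.
have tu : 0 < t * u.
  rewrite lt_neqAle tu0 andbT; apply: contraTneq btu => <-.
  by rewrite mulr0 ltxx.
have nb : 0 < - b by rewrite -(pmulr_lgt0 _ tu).
split; first by rewrite -oppr_gt0.
rewrite -(ltr_pM2r (exprn_gt0 2 tu)).
have -> : b ^+ 2 * (t * u) ^+ 2 = (- b * (t * u)) ^+ 2 by ring.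
apply: le_lt_trans (_ : (a * t ^+ 2 + c * u ^+ 2) ^+ 2 < _); last first.
  by rewrite ltrXn2r.
rewrite -subr_ge0.
have -> : (a * t ^+ 2 + c * u ^+ 2) ^+ 2 - 4 * (a * c) * (t * u) ^+ 2 =
   (a * t ^+ 2 - c * u ^+ 2) ^+ 2 by ring.
by rewrite real_exprn_even_ge0 // rpredB // rpredM ?rpredX // ger0_real.
Qed.

(* The isotropic vectors (-b + s, 2a) and (2c, -b + s), with s^2 the
   discriminant, have nonnegative coordinates and span the plane. *)
Lemma rotation_segment (g1 g2 h1 h2 : C) :
  0 <= 'Im (g1 * h1^* ) -> 0 <= 'Im (g2 * h2^* ) ->
  (forall x y, 0 <= x -> 0 <= y -> 0 < x + y ->
     'Im ((x * g1 + y * g2) * (x * h1 + y * h2)^* ) = 0 ->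
     x * g1 + y * g2 = x * h1 + y * h2) ->
  forall x y, 0 <= x -> 0 <= y ->
    0 <= 'Im ((x * g1 + y * g2) * (x * h1 + y * h2)^* ).
Proof.
set a := 'Im (g1 * _); set c := 'Im (g2 * _) => a0 c0 iso x y x0 y0.
pose b := 'Im (g1 * h2^* + g2 * h1^* ).
have Q z w : 0 <= z -> 0 <= w -> 'Im ((z * g1 + w * g2) * (z * h1 + w * h2)^* ) =
   a * z ^+ 2 + b * (z * w) + c * w ^+ 2.
  move=> z0 w0; rewrite rmorphD !rmorphM /= (CrealP (ger0_real z0)) (CrealP (ger0_real w0)).
  rewrite /a /b /c; have -> : (z * g1 + w * g2) * (z * h1^* + w * h2^* ) =
    z ^+ 2 * (g1 * h1^* ) + (z * w) * (g1 * h2^* + g2 * h1^* ) + w ^+ 2 * (g2 * h2^* ) by ring.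
  have zr := ger0_real z0; have wr := ger0_real w0.
  rewrite 2!raddfD /= (ImMl (rpredX 2 zr)) (ImMl (rpredM zr wr)) (ImMl (rpredX 2 wr)).
  ring.
rewrite real_leNgt ?Creal_Im //; apply/negP; rewrite Q // => neg.
have br : b \is Num.real by exact: Creal_Im.
have [b0 disc] := indefinite_quadratic a0 br c0 x0 y0 neg.
pose s := sqrtC (b ^+ 2 - 4 * (a * c)).
have s2 : s ^+ 2 = b ^+ 2 - 4 * (a * c) by rewrite sqrtCK.
have s0 : 0 <= s by rewrite sqrtC_ge0 subr_ge0 ltW.
have e0 : 0 < s - b by rewrite ltr_wpDl // oppr_gt0.
have a20 : 0 <= 2 * a by rewrite mulr_ge0.
have c20 : 0 <= 2 * c by rewrite mulr_ge0.
have d1 : (s - b) * g1 + 2 * a * g2 = (s - b) * h1 + 2 * a * h2.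
  apply: iso => //; [exact: ltW|by rewrite ltr_wpDr|rewrite Q // ?(ltW e0) //].
  have -> : a * (s - b) ^+ 2 + b * ((s - b) * (2 * a)) + c * (2 * a) ^+ 2 =
     a * (s ^+ 2 - b ^+ 2 + 4 * (a * c)) by ring.
  by rewrite s2; ring.
have d2 : 2 * c * g1 + (s - b) * g2 = 2 * c * h1 + (s - b) * h2.
  apply: iso => //; [exact: ltW|by rewrite ltr_wpDl|rewrite Q // ?(ltW e0) //].
  have -> : a * (2 * c) ^+ 2 + b * (2 * c * (s - b)) + c * (s - b) ^+ 2 =
     c * (s ^+ 2 - b ^+ 2 + 4 * (a * c)) by ring.
  by rewrite s2; ring.
have det0 : (s - b) ^+ 2 - 4 * (a * c) != 0.
  rewrite gt_eqF // subr_gt0 (lt_le_trans disc) //.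
  have -> : (s - b) ^+ 2 = b ^+ 2 + (s ^+ 2 + 2 * s * - b) by ring.
  by rewrite lerDl addr_ge0 ?exprn_ge0 // !mulr_ge0 // oppr_ge0 ltW.
have gh1 : g1 = h1.
  apply: (mulfI det0).
  have -> : ((s - b) ^+ 2 - 4 * (a * c)) * g1 = (s - b) * ((s - b) * g1 + 2 * a * g2)
     - 2 * a * (2 * c * g1 + (s - b) * g2) by ring.
  by rewrite d1 d2; ring.
have gh2 : g2 = h2.
  apply: (mulfI det0).
  have -> : ((s - b) ^+ 2 - 4 * (a * c)) * g2 = (s - b) * (2 * c * g1 + (s - b) * g2)
     - 2 * c * ((s - b) * g1 + 2 * a * g2) by ring.
  by rewrite d1 d2; ring.
move: neg; rewrite -Q // gh1 gh2 -normCK.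
by rewrite (Creal_ImP _ _) ?ltxx // rpredX // normr_real.
Qed.

(* V^h B V = B + u^h u - v^h v, so both values lie, as seen from F (B - v^h v),
   in the same open half-plane. *)
Lemma rotating_convex m (F : 'M[C]_m -> C) (V : 'M_m) (p q : C) :
  rotating F -> (\rank (V - 1%:M)%R <= 1)%N -> 0 <= p -> 0 <= q -> 0 < p + q ->
  rotating (fun B => p * F B + q * F (V^h *m B *m V)).
Proof.
move=> rF rV.
pose G x y B := x * F B + y * F (V^h *m B *m V).
have nz x y B : 0 <= x -> 0 <= y -> 0 < x + y -> selfadjoint B -> G x y B != 0.
  move=> x0 y0 xy hB; have [u [v e]] := congr_reflection rV hB.
  have hv (w : 'rV_m) := selfadjoint_rank1 w.
  have hB0 : selfadjoint (B - v^h *m v) by apply: selfadjointD => //; apply: selfadjointN.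
  have [h0 line] := rF _ hB0.
  have nzl (w : 'rV_m) s : s \is Num.real -> F (B - v^h *m v) +
     s * (F (B - v^h *m v + w^h *m w) - F (B - v^h *m v)) != 0.
    move=> sr; have [<- _] := line w; apply: (proj1 (rF _ _)).
    by apply: selfadjointD => //; apply: selfadjointZ.
  have lv := nzl v; have lu := nzl u.
  have [_ sv] := line v; have [_ su] := line u.
  rewrite /G e -addrAC -[B in F B](subrK (v^h *m v)).
  by apply: rotation_convex lv lu sv su.
have aff x y B (w : 'rV_m) s : selfadjoint B ->
    G x y (B + s *: (w^h *m w)) = G x y B + s * (G x y (B + w^h *m w) - G x y B).
  move=> hB; rewrite /G.
  have VE z : V^h *m (B + z *: (w^h *m w)) *m V =
     V^h *m B *m V + z *: ((w *m V)^h *m (w *m V)).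
    by rewrite mulmxDr mulmxDl -scalemxAr -scalemxAl ctmxM !mulmxA.
  rewrite VE; have := VE 1; rewrite !scale1r => ->.
  have [_ /(_ w)[-> _]] := rF _ hB.
  have [_ /(_ (w *m V))[-> _]] := rF _ (selfadjoint_congr V hB).
  ring.
move=> p0 q0 pq B hB; split; first exact: nz.
move=> w; split=> [s|]; first exact: aff.
have VE : V^h *m (B + w^h *m w) *m V = V^h *m B *m V + (w *m V)^h *m (w *m V).
  by rewrite mulmxDr mulmxDl ctmxM !mulmxA.
rewrite VE; apply: rotation_segment => //.
- by have [_ /(_ w)[]] := rF _ hB.
- by have [_ /(_ (w *m V))[]] := rF _ (selfadjoint_congr V hB).
move=> x y x0 y0 xy; apply: real_rotation_trivial => s sr.
have := aff x y B w s hB; rewrite /G VE => <-.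
by apply: nz => //; apply: selfadjointD => //; apply: selfadjointZ => //; exact: selfadjoint_rank1.
Qed.

End HermitianForms.

(** * Real rooted polynomials with positive coefficients *)

Section RealRootedPolynomials.
Variable C : numClosedFieldType.
Implicit Types (p q f g : {poly C}).

Definition monic_deg n p := p \is monic /\ size p = n.+1.

Definition has_real_roots p := forall z, root p z -> z \is Num.real.

Definition pos_coefs p := forall i, (i < size p)%N -> 0 < p`_i.

Lemma monic_degP n p : monic_deg n p <-> p`_n = 1 /\ (size p <= n.+1)%N.
Proof.
split=> [[/monicP pm ps]|[pn ps]].
  by rewrite -pm /lead_coef ps.
have sp : size p = n.+1.
  apply/eqP; rewrite eqn_leq ps ltnNge; apply/negP => /(nth_default 0).
  by rewrite pn => /eqP; rewrite oner_eq0.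
by split=> //; apply/monicP; rewrite /lead_coef sp.
Qed.

Lemma monic_deg_convex n (a b : C) f g : a + b = 1 ->
  monic_deg n f -> monic_deg n g -> monic_deg n (a *: f + b *: g).
Proof.
move=> ab /monic_degP[f1 fs] /monic_degP[g1 gs]; apply/monic_degP; split.
  by rewrite coefD !coefZ f1 g1 !mulr1.
rewrite (leq_trans (size_polyD _ _)) // geq_max.
by rewrite !(leq_trans (size_scale_leq _ _)).
Qed.

Lemma monic_splits n p : monic_deg n p ->
  exists2 rs : seq C, size rs = n & p = \prod_(r <- rs) ('X - r%:P).
Proof.
case=> pm ps; have [rs] := closed_field_poly_normal p.
rewrite (monicP pm) scale1r => e; exists rs => //.
by have := ps; rewrite e size_prod_XsubC => -[].
Qed.

Lemma norm_real_rooted n p z : monic_deg n p -> has_real_roots p ->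
  `|'Im z| ^+ n <= `|p.[z]|.
Proof.
move=> /monic_splits[rs <- ->] rr; rewrite horner_prod normr_prod.
have {rr} : all (fun r => r \is Num.real) rs.
  by apply/allP => r rs_r; apply: rr; rewrite root_prod_XsubC.
elim: rs => [|r rs IH] /=; first by rewrite big_nil expr0.
move=> /andP[rr /IH {}IH]; rewrite big_cons exprS ler_pM ?exprn_ge0 //.
rewrite hornerXsubC.
have -> : 'Im z = 'Im (z - r) by rewrite raddfB /= (Creal_ImP _ rr) subr0.
rewrite -(ler_pXn2r (isT : (0 < 2)%N)) ?nnegrE // [leRHS]normC2_Re_Im.
by rewrite real_normK ?Creal_Im // lerDr real_exprn_even_ge0 ?Creal_Re.
Qed.

Lemma real_rooted_coef n p i : monic_deg n p -> has_real_roots p ->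
  p`_i \is Num.real.
Proof.
move=> /monic_splits[rs _ ->] rr; apply/polyOverP.
rewrite big_seq; apply: rpred_prod => r rs_r; rewrite polyOverXsubC.
by apply: rr; rewrite root_prod_XsubC.
Qed.

Lemma pos_coefs_neg_roots n p : monic_deg n p -> (forall z, root p z -> z < 0) ->
  pos_coefs p.
Proof.
move=> /monic_splits[rs _ ->] rr; rewrite /pos_coefs size_prod_XsubC.
have {rr} : all (fun r => r < 0) rs.
  by apply/allP => r rs_r; apply: rr; rewrite root_prod_XsubC.
elim: rs => [_ [|i] //|r rs IH] /=; first by rewrite big_nil coef1.
move=> /andP[rr /IH {}IH] i; rewrite big_cons mulrBl coefB coefXM coefCM.
set q := \prod_(_ <- _) _ in IH *.
have q0 j : 0 <= q`_j.
  have [/IH/ltW//|sj] := ltnP j (size rs).+1.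
  by rewrite nth_default // size_prod_XsubC.
case: i => [_|i] /=.
  by rewrite sub0r oppr_gt0 nmulr_rlt0 // IH.
rewrite ltnS => /IH qi; rewrite ltr_wpDr // oppr_ge0 nmulr_rle0 //.
Qed.

Lemma pos_coefs_horner_gt0 p z : p != 0 -> (forall i, 0 <= p`_i) -> 0 < p`_0 ->
  0 <= z -> 0 < p.[z].
Proof.
move=> p0 pge pgt z0; rewrite horner_coef.
move: (size p) (polySpred p0) => s ->; rewrite big_ord_recl expr0 mulr1.
by rewrite ltr_wpDr // sumr_ge0 // => i _; rewrite mulr_ge0 // exprn_ge0.
Qed.

Lemma pos_coefs_nonneg p i : pos_coefs p -> 0 <= p`_i.
Proof.
move=> pp; have [/pp/ltW//|sj] := ltnP i (size p).
by rewrite nth_default.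
Qed.

(* At the first point of the segment where some coefficient vanishes, the roots
   are real and nonpositive, hence negative as the constant term is still
   positive, so that no coefficient can vanish there. *)
Lemma pos_coefs_segment n f g :
  monic_deg n f -> monic_deg n g -> has_real_roots g ->
  (forall t : C, 0 <= t -> t <= 1 -> has_real_roots ((1 - t) *: f + t *: g)) ->
  pos_coefs f -> 0 < g`_0 -> pos_coefs g.
Proof.
move=> mf mg gr seg fp g0.
have [/forallP h|] := boolP [forall i : 'I_n.+1, 0 < g`_i].
  by move=> i; case: mg => _ -> ilt; exact: (h (Ordinal ilt)).
rewrite negb_forall => /existsP[i0 i0P].
have real_g i : g`_i \is Num.real by exact: real_rooted_coef mg gr.
have fpos (i : 'I_n.+1) : 0 < f`_i by apply: fp; case: mf => _ ->.
pose S := [pred i : 'I_n.+1 | ~~ (0 < g`_i)].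
have Sle i : S i -> g`_i <= 0 by rewrite /= real_leNgt.
pose T (i : 'I_n.+1) := f`_i / (f`_i - g`_i).
have den i : S i -> 0 < f`_i - g`_i.
  by move=> /Sle gi; rewrite subr_gt0 (le_lt_trans gi).
have T_real : {in S, forall i, T i \is Num.real}.
  by move=> i _; rewrite rpredM ?rpredV ?rpredB ?(gtr0_real (fpos i)).
case: (@real_arg_minP _ _ i0 S T i0P T_real) => j Sj Tmin.
have T0 : 0 < T j by rewrite divr_gt0 ?fpos ?den.
have T1 : T j <= 1 by rewrite ler_pdivrMr ?den // mul1r lerDl oppr_ge0 Sle.
pose q := (1 - T j) *: f + T j *: g.
have mq : monic_deg n q by apply: monic_deg_convex; rewrite ?subrK.
have qE i : q`_i = f`_i - T j * (f`_i - g`_i) by rewrite coefD !coefZ; ring.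
have qj : q`_j = 0 by rewrite qE divfK ?subrr // gt_eqF ?den.
have qpos (i : 'I_n.+1) : 0 < g`_i -> 0 < q`_i.
  move=> gi; rewrite coefD !coefZ ltr_wpDl //; last by rewrite mulr_gt0.
  by rewrite mulr_ge0 ?subr_ge0 // ltW.
have q_ge0 i : 0 <= q`_i.
  have [ilt|ige] := ltnP i n.+1; last by rewrite nth_default //; case: mq => _ ->.
  have -> : i = Ordinal ilt by []; move: (Ordinal ilt) => {ilt}i.
  have [/qpos/ltW//|Si] := boolP (0 < g`_i).
  rewrite qE subr_ge0 -ler_pdivlMr ?den //; exact: Tmin.
have q00 : 0 < q`_0 by apply: (qpos ord0).
have qn0 : q != 0 by apply: monic_neq0; case: mq.
have : pos_coefs q.
  apply: (pos_coefs_neg_roots mq) => z rz.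
  have zr : z \is Num.real by apply: seg rz => //; exact: ltW.
  rewrite real_ltNge //; apply/negP => z0.
  by have := pos_coefs_horner_gt0 qn0 q_ge0 q00 z0; rewrite (eqP rz) ltxx.
by move=> /(_ j); rewrite qj ltxx; case: mq => _ -> /(_ (ltn_ord j)).
Qed.

Lemma pos_coefs_convex n (a b : C) f g :
  0 <= a -> 0 <= b -> a + b = 1 -> monic_deg n f -> monic_deg n g ->
  (forall s t : C, 0 <= s -> 0 <= t -> s + t = 1 -> has_real_roots (s *: f + t *: g)) ->
  pos_coefs (a *: f + b *: g) -> pos_coefs f \/ pos_coefs g.
Proof.
move=> a0 b0 ab mf mg rr pm.
have fr : has_real_roots f.
  by have := rr 1 0 ler01 (lexx _) (addr0 _); rewrite scale1r scale0r addr0.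
have gr : has_real_roots g.
  by have := rr 0 1 (lexx _) ler01 (add0r _); rewrite scale1r scale0r add0r.
have mm := monic_deg_convex ab mf mg.
have : 0 < a * f`_0 + b * g`_0.
  by have := pm 0; rewrite (proj2 mm) coefD !coefZ => /(_ isT).
have [f0 _|f0] := real_ltP (real0 C) (real_rooted_coef 0 mf fr).
  left; apply: (pos_coefs_segment mm mf fr _ pm f0) => t t0 t1.
  have -> : (1 - t) *: (a *: f + b *: g) + t *: f =
      ((1 - t) * a + t) *: f + ((1 - t) * b) *: g.
    by rewrite scalerDr !scalerA addrAC -scalerDl.
  apply: rr; rewrite ?addr_ge0 ?mulr_ge0 ?subr_ge0 //.
  by rewrite addrAC -mulrDr ab mulr1 subrK.
have [g0 _|g0] := real_ltP (real0 C) (real_rooted_coef 0 mg gr).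
  right; apply: (pos_coefs_segment mm mg gr _ pm g0) => t t0 t1.
  have -> : (1 - t) *: (a *: f + b *: g) + t *: g =
      ((1 - t) * a) *: f + ((1 - t) * b + t) *: g.
    by rewrite scalerDr !scalerA -addrA -scalerDl.
  apply: rr; rewrite ?addr_ge0 ?mulr_ge0 ?subr_ge0 //.
  by rewrite addrA -mulrDr ab mulr1 subrK.
by move=> /lt_geF; rewrite -[leRHS]addr0 lerD // mulr_ge0_le0.
Qed.

Lemma monic_deg_shift n p c : monic_deg n p -> monic_deg n (p \Po ('X + c%:P)).
Proof.
case=> pm ps; split; last by rewrite size_comp_poly2 // size_XaddC.
by rewrite monicE lead_coef_comp ?size_XaddC // (monicP pm) lead_coefXaddC expr1n mul1r.
Qed.

Lemma root_shift p c z : root (p \Po ('X + c%:P)) z = root p (z + c).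
Proof. by rewrite /root horner_comp !hornerE. Qed.

Lemma has_real_roots_shift p c : c \is Num.real -> has_real_roots p ->
  has_real_roots (p \Po ('X + c%:P)).
Proof.
move=> cr pr z; rewrite root_shift => /pr zc.
by rewrite -(addrK c z) rpredB.
Qed.

Lemma pos_coefs_shift n p c : monic_deg n p ->
  (forall z, root p z -> z < c) -> pos_coefs (p \Po ('X + c%:P)).
Proof.
move=> mp lt; apply: (pos_coefs_neg_roots (monic_deg_shift c mp)) => z.
by rewrite root_shift => /lt; rewrite -subr_gt0 opprD addrCA subrr addr0 oppr_gt0.
Qed.

Lemma pos_coefs_shift_root p c z : p != 0 ->
  pos_coefs (p \Po ('X + c%:P)) -> root p z -> ~~ (c <= z).
Proof.
move=> p0 pp rz; apply/negP => cz.
have q0 : p \Po ('X + c%:P) != 0.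
  by rewrite -size_poly_gt0 size_comp_poly2 ?size_XaddC // size_poly_gt0.
have zc : 0 <= z - c by rewrite subr_ge0.
have c0 := pp 0%N; rewrite size_poly_gt0 in c0.
have := pos_coefs_horner_gt0 q0 (fun i => pos_coefs_nonneg i pp) (c0 q0) zc.
by rewrite horner_comp !hornerE subrK (eqP rz) ltxx.
Qed.

End RealRootedPolynomials.

(** * Lazy random walks on a finite group *)

Section LazyWalk.
Variables (F : numClosedFieldType) (gT : finGroupType).
Implicit Types (s : seq gT) (x y : gT).

(* The expectation of phi (x * t_1^e_1 * ... * t_n^e_n), for s = t_1 ... t_n
   and independent fair bits e_i. *)
Fixpoint walk (V : lmodType F) s (phi : gT -> V) x : V :=
  if s is t :: s' then 2^-1 *: (walk s' phi x + walk s' phi (x * t)%g)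
  else phi x.

Let half0 : 0 < 2^-1 :> F. Proof. by rewrite invr_gt0 ltr0n. Qed.

Let half1 : 2^-1 < 1 :> F. Proof. by rewrite invf_lt1 ?ltr0n // ltr1n. Qed.

Let in01M (a b : F) : 0 < a <= 1 -> 0 < b <= 1 -> 0 < a * b <= 1.
Proof.
move=> /andP[a0 a1] /andP[b0 b1].
by rewrite mulr_gt0 // mulr_ile1 // ltW.
Qed.

Lemma eq_walk (V : lmodType F) s (phi psi : gT -> V) x :
  phi =1 psi -> walk s phi x = walk s psi x.
Proof. by move=> e; elim: s x => //= t s IH x; rewrite !IH. Qed.

Lemma walk_shift (V : lmodType F) s (phi : gT -> V) x y :
  walk s phi (x * y)%g = walk s (fun z => phi (x * z)%g) y.
Proof. by elim: s y => //= t s IH y; rewrite -IH -IH mulgA. Qed.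

Lemma walk_linear (V W : lmodType F) (l : V -> W) s (phi : gT -> V) x :
  {morph l : u v / u + v} -> (forall a u, l (a *: u) = a *: l u) ->
  walk s (fun y => l (phi y)) x = l (walk s phi x).
Proof. by move=> lD lZ; elim: s x => //= t s IH x; rewrite !IH lZ lD. Qed.

Lemma walk_cat (V : lmodType F) s1 s2 (phi : gT -> V) x :
  walk (s1 ++ s2) phi x = walk s1 (walk s2 phi) x.
Proof. by elim: s1 x => //= t s IH x; rewrite !IH. Qed.

Lemma sum_walk (V : lmodType F) s (phi : gT -> V) :
  \sum_x walk s phi x = \sum_x phi x.
Proof.
elim: s => //= t s IH; rewrite -scaler_sumr big_split /=.
have -> : \sum_x walk s phi (x * t)%g = \sum_x walk s phi x.
  by rewrite [RHS](reindex_inj (mulIg t)).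
rewrite IH -mulr2n -scaler_nat scalerA.
by rewrite mulVf ?pnatr_eq0 // scale1r.
Qed.

Lemma walk_ge0 s (phi : gT -> F^o) x :
  (forall y, 0 <= phi y) -> 0 <= (walk s phi x : F).
Proof.
move=> phi0; elim: s x => //= t s IH x.
by rewrite mulr_ge0 ?invr_ge0 ?ler0n // addr_ge0.
Qed.

Lemma walk_cst s (a : F^o) x : walk s (fun=> a) x = a.
Proof.
elim: s x => //= t s IH x; rewrite !IH -mulr2n -scaler_nat scalerA.
by rewrite mulVf ?pnatr_eq0 // scale1r.
Qed.

Lemma walk_stay s (phi : gT -> F^o) x : (forall y, 0 <= phi y) ->
  2^-1 ^+ size s * (phi x : F) <= walk s phi x.
Proof.
move=> phi0; elim: s x => [|t s IH] x /=; first by rewrite expr0 mul1r.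
rewrite exprS -mulrA ler_pM2l ?invr_gt0 ?ltr0n //.
by rewrite (le_trans (IH x)) // lerDl walk_ge0.
Qed.

Lemma walk_mass s (phi : gT -> F^o) x :
  (walk s phi x : F) =
  \sum_y (walk s (fun z => (z == y)%:R : F^o) 1%g : F) * phi (x * y)%g.
Proof.
elim: s x phi => [|t s IH] x phi /=.
  rewrite (bigD1 1%g) //= eqxx mul1r mulg1 big1 ?addr0 // => y.
  by rewrite eq_sym => /negPf ->; rewrite mul0r.
under eq_bigr => y _ do rewrite -mulrA mulrDl.
rewrite -mulr_sumr big_split /= -IH; congr (_ * (_ + _)).
under [RHS]eq_bigr => y _ do rewrite IH mulr_suml.
rewrite exchange_big /= IH; apply: eq_bigr => z _.
rewrite (bigD1 (t * z)%g) //= mul1g eqxx mulr1 mulgA big1 ?addr0 // => y.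
by rewrite eq_sym => /negPf ->; rewrite mulr0 mul0r.
Qed.

Variable T : {set gT}.
Hypothesis genT : <<T>>%g = [set: gT].

Lemma walk_reach y : exists2 s, all (mem T) s & exists2 d : F, 0 < d <= 1 &
  forall (phi : gT -> F^o) x, (forall z, 0 <= phi z) ->
    d * (phi (x * y)%g : F) <= walk s phi x.
Proof.
have : y \in <<T>>%g by rewrite genT inE.
case/gen_prodgP => n [c cT ->] {y}.
elim: n c cT => [|n IH] c cT.
  exists [::] => //; exists 1 => [|phi x _]; first by rewrite ltr01 lexx.
  by rewrite big_ord0 mulg1 mul1r.
have [|s sT [d /andP[d0 dle] H]] := IH (fun i => c (lift ord0 i)); first by move=> i; exact: cT.
exists (c ord0 :: s); first by rewrite /= cT.
exists (2^-1 * d) => [|phi x phi0]; first by rewrite in01M ?half0 ?d0 ?(ltW half1).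
rewrite /= big_ord_recl mulgA -mulrA ler_pM2l ?invr_gt0 ?ltr0n //.
by rewrite (le_trans (H _ _ phi0)) // lerDr walk_ge0.
Qed.

Lemma walk_minorized : exists2 s, all (mem T) s & exists2 d : F, 0 < d <= 1 &
  forall (phi : gT -> F^o) x, (forall z, 0 <= phi z) ->
    d * \sum_y (phi y : F) <= #|gT|%:R * walk s phi x.
Proof.
have [s sT [d /andP[d0 dle] H]] : exists2 s, all (mem T) s & exists2 d : F, 0 < d <= 1 &
    forall y, y \in enum gT -> forall (phi : gT -> F^o) x, (forall z, 0 <= phi z) ->
    d * (phi (x * y)%g : F) <= walk s phi x.
  elim: (enum gT) => [|y ys [s2 s2T [d2 /andP[d20 d2le] H2]]].
    by exists [::] => //; exists 1; rewrite ?ltr01 ?lexx.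
  have [s1 s1T [d1 /andP[d10 d1le] H1]] := walk_reach y.
  exists (s1 ++ s2); first by rewrite all_cat s1T.
  pose h k : F := 2^-1 ^+ k.
  have hk k : 0 < h k <= 1.
    by rewrite exprn_gt0 // exprn_ile1 // ltW.
  have dh1 : 0 < d1 * h (size s2) <= 1 by rewrite in01M // d10.
  have dh2 : 0 < d2 * h (size s1) <= 1 by rewrite in01M // d20.
  exists ((d1 * h (size s2)) * (d2 * h (size s1))); first exact: in01M.
  move=> z; rewrite inE => zP phi x phi0; rewrite walk_cat.
  have w0 u : 0 <= (walk s2 phi u : F) by apply: walk_ge0.
  case/orP: zP => [/eqP ->|zys].
    apply: le_trans (H1 (walk s2 phi) x w0).
    rewrite [leLHS](_ : _ = d1 * (h (size s2) * phi (x * y)%g * (d2 * h (size s1)))); last first.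
      by ring.
    rewrite ler_pM2l //; apply: le_trans (walk_stay s2 (x * y)%g phi0).
    rewrite ler_piMr ?mulr_ge0 ?(ltW (proj1 (andP (hk _)))) //.
    by case/andP: dh2.
  apply: le_trans (walk_stay s1 x w0).
  rewrite [leLHS](_ : _ = h (size s1) * (d2 * phi (x * z)%g * (d1 * h (size s2)))); last first.
    by ring.
  rewrite ler_pM2l; last by case/andP: (hk (size s1)).
  apply: le_trans (H2 z zys phi x phi0).
  rewrite ler_piMr ?mulr_ge0 ?(ltW d20) //.
  by case/andP: dh1.
exists s => //; exists d => [|phi x phi0]; first by rewrite d0.
rewrite (reindex_inj (mulgI x)) mulr_sumr -sum1_card natr_sum mulr_suml.
by apply: ler_sum => y _; rewrite mul1r H // mem_enum.
Qed.

Hypothesis archi : forall a : F, 0 <= a -> exists n, a < n%:R.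

Lemma exp_small (a e : F) : 0 <= a < 1 -> 0 < e -> exists n, a ^+ n <= e.
Proof.
move=> /andP[a0 a1] e0.
have b0 : 0 < 1 - a by rewrite subr_gt0.
have bernoulli n : (1 + n%:R * (1 - a)) * a ^+ n <= 1.
  elim: n => [|n IH]; first by rewrite mul0r addr0 mul1r.
  apply: le_trans IH; rewrite exprS mulrA ler_wpM2r ?exprn_ge0 // -subr_ge0.
  have -> : 1 + n%:R * (1 - a) - (1 + n.+1%:R * (1 - a)) * a =
     n.+1%:R * (1 - a) ^+ 2 by rewrite -natr1; ring.
  by rewrite mulr_ge0 ?ler0n // exprn_ge0 // ltW.
have [|n] := archi (a := e^-1 / (1 - a)).
  by rewrite divr_ge0 ?invr_ge0 ?ltW.
rewrite ltr_pdivrMr // => ltn; exists n.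
have lt1 : e^-1 < 1 + n%:R * (1 - a) by rewrite ltr_wpDl.
have c0 := lt_trans (_ : 0 < e^-1) lt1; rewrite invr_gt0 in c0.
rewrite -(ler_pM2l (c0 e0)) (le_trans (bernoulli n)) //.
by rewrite -[leLHS](mulVf (lt0r_neq0 e0)) ler_pM2r // ltW.
Qed.

Let mean (phi : gT -> F^o) : F := #|gT|%:R^-1 * \sum_y phi y.

Let card_gt0 : 0 < #|gT|%:R :> F.
Proof. by rewrite ltr0n; apply/card_gt0P; exists 1%g. Qed.

Lemma walk_lower_bound (e : F) : 0 < e -> exists2 s, all (mem T) s &
  forall (phi : gT -> F^o) x, (forall z, 0 <= phi z) ->
    (1 - e) * mean phi <= walk s phi x.
Proof.
move=> e0; have [s sT [d /andP[d0 d1] H]] := walk_minorized.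
have [|n ne] := @exp_small (1 - d) e _ e0.
  by rewrite subr_ge0 d1 /= gtrDl oppr_lt0.
exists (flatten (nseq n s)).
  by elim: n {ne} => //= n IH; rewrite all_cat sT.
move=> phi x phi0.
have m0 (psi : gT -> F^o) : (forall z, 0 <= psi z) -> 0 <= mean psi.
  by move=> psi0; rewrite mulr_ge0 ?invr_ge0 ?ler0n // sumr_ge0.
apply: le_trans (_ : (1 - (1 - d) ^+ n) * mean phi <= _).
  by rewrite ler_wpM2r ?m0 // lerD2l lerN2.
elim: n phi x phi0 {ne} => [|n IH] phi x phi0; first by rewrite subrr mul0r /=.
have -> : flatten (nseq n.+1 s) = flatten (nseq n s) ++ s.
  by elim: {IH} n => [|n IH] /=; rewrite ?cats0 // -catA -IH.
rewrite walk_cat.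
have low y : d * mean phi <= walk s phi y.
  rewrite -(ler_pM2l card_gt0) mulrCA /mean mulVKf ?gt_eqF //; exact: H.
pose psi y : F^o := walk s phi y - d * mean phi.
have psi0 y : 0 <= psi y by rewrite subr_ge0.
have -> : walk (flatten (nseq n s)) (walk s phi) x =
          walk (flatten (nseq n s)) psi x + (d * mean phi : F).
  elim: (flatten _) x => /= [|t r IHr] x; first by rewrite /psi subrK.
  rewrite !IHr addrACA scalerDr -mulr2n -scaler_nat scalerA.
  by rewrite mulVf ?pnatr_eq0 // scale1r.
rewrite -lerBlDr; apply: le_trans (IH psi x psi0).
have -> : mean psi = (1 - d) * mean phi.
  have E (a : F) : #|gT|%:R^-1 * (a *+ #|gT|) = a.
    by rewrite -[a *+ _]mulr_natl mulKf ?gt_eqF.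
  by rewrite {1}/mean /psi sumrB sum_walk sumr_const mulrBr E mulrBl mul1r.
by rewrite le_eqVlt; apply/orP; left; apply/eqP; rewrite exprS; ring.
Qed.

Theorem walk_equidistributed (e : F) : 0 < e -> exists2 s, all (mem T) s &
  forall (phi : gT -> F^o) x,
    `|(walk s phi x : F) - mean phi| <= e * \sum_y `|phi y|.
Proof.
move=> e0; have [s sT H] := walk_lower_bound e0; exists s => // phi x.
pose mu y : F := walk s (fun z => (z == y)%:R : F^o) 1%g.
pose exc y := mu y - (1 - e) / #|gT|%:R.
have exc0 y : 0 <= exc y.
  rewrite subr_ge0; have := H (fun z => (z == y)%:R : F^o) 1%g (fun z => ler0n _ _).
  rewrite /mean (bigD1 y) //= eqxx big1 ?addr0 ?mulr1 // => z.
  by move=> /negPf ->.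
have sum_exc : \sum_y exc y = e.
  have mu1 : \sum_y mu y = 1.
    have := walk_mass s (fun=> 1) 1%g; rewrite walk_cst => ->.
    by apply: eq_bigr => y _; rewrite mulr1.
  rewrite sumrB mu1 sumr_const -[_ *+ _]mulr_natr divfK ?gt_eqF //; ring.
have exc1 y : exc y <= e.
  by rewrite -sum_exc (bigD1 y) //= lerDl sumr_ge0.
rewrite walk_mass /mean [X in _ * X](reindex_inj (mulgI x)).
rewrite [X in _ <= e * X](reindex_inj (mulgI x)) !mulr_sumr -sumrB.
apply: le_trans (ler_norm_sum _ _ _) _; apply: ler_sum => y _.
rewrite -mulrBl normrM ler_wpM2r //.
have k0 : 0 <= e / #|gT|%:R by rewrite divr_ge0 ?ler0n // ltW.
have ke : e / #|gT|%:R <= e.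
  rewrite ler_pdivrMr // ler_peMr ?(ltW e0) // ler1n; move: card_gt0.
  by rewrite ltr0n.
have -> : walk s (fun z => (z == y)%:R : F^o) 1%g - #|gT|%:R^-1 = exc y - e / #|gT|%:R.
  by rewrite /exc /mu; ring.
have rr : exc y - e / #|gT|%:R \is Num.real by rewrite rpredB ?ger0_real.
rewrite (real_ler_norml _ rr) lerBrDr lerBlDr.
apply/andP; split; first by apply: le_trans (exc0 y); rewrite addrC subr_le0.
by rewrite (le_trans (exc1 y)) // lerDl.
Qed.

End LazyWalk.

(** * Averages over groups generated by reflections *)

Section ReflectionAction.
Variable C : numClosedFieldType.

Lemma eq_rotating m (F G : 'M[C]_m -> C) : F =1 G -> rotating F -> rotating G.
Proof.
move=> e rF B hB; have [h0 H] := rF B hB; split; first by rewrite -e.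
by move=> w; have [aff im] := H w; split=> [s|]; rewrite -!e.
Qed.

Lemma real_roots_of_upper n m (Q : 'M[C]_m -> {poly C}) :
  (forall B z, selfadjoint B -> 0 < 'Im z -> (Q B).[z] != 0) ->
  (forall B z, (Q (- B)).[- z] = (-1) ^+ n * (Q B).[z]) ->
  forall B, selfadjoint B -> has_real_roots (Q B).
Proof.
move=> up neg B hB z rz; apply/Creal_ImP.
case: (real_ltgtP (real0 C) (Creal_Im z)) => // Imz.
  by have := up B z hB Imz; rewrite (eqP rz) eqxx.
have := up (- B) (- z) (selfadjointN hB).
rewrite raddfN oppr_gt0 => /(_ Imz).
by rewrite neg (eqP rz) mulr0 eqxx.
Qed.

Lemma horner_lin (p q : {poly C}) (a b z : C) :
  (a *: p + b *: q).[z] = a * p.[z] + b * q.[z].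
Proof. by rewrite hornerD !hornerZ. Qed.

Lemma comp_poly_lin (p q r : {poly C}) (a b : C) :
  (a *: p + b *: q) \Po r = a *: (p \Po r) + b *: (q \Po r).
Proof. by rewrite comp_polyD !comp_polyZ. Qed.

Lemma horner_lin_scale (p q p' q' : {poly C}) (a b c y z : C) :
  p.[y] = c * p'.[z] -> q.[y] = c * q'.[z] ->
  (a *: p + b *: q).[y] = c * (a *: p' + b *: q').[z].
Proof. by rewrite !horner_lin => -> ->; ring. Qed.

Lemma largest_real_root n (p : {poly C}) : monic_deg n.+1 p -> has_real_roots p ->
  exists r, [/\ r \is Num.real, root p r & forall z, root p z -> z <= r].
Proof.
move=> /monic_splits[rs srs ->] rr.
have {rr} rsr : forall r, r \in rs -> r \is Num.real.
  by move=> r rin; apply: rr; rewrite root_prod_XsubC.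
have [r [rin rmax]] : exists r, r \in rs /\ forall z, z \in rs -> z <= r.
  elim: rs n srs rsr => // r [|r' rs] IH n [srs] rsr.
    by exists r; split=> [|z]; rewrite ?inE // => /eqP ->.
  have [||q [qin qmax]] := IH (size rs).
  - by [].
  - by move=> z zin; apply: rsr; rewrite inE zin orbT.
  have rR : r \is Num.real by apply: rsr; rewrite inE eqxx.
  have qR : q \is Num.real by apply: rsr; rewrite inE qin orbT.
  have [rq|/ltW qr] := real_leP rR qR.
    exists q; split=> [|z]; first by rewrite inE qin orbT.
    by rewrite inE => /orP[/eqP ->|/qmax].
  exists r; split=> [|z]; first by rewrite inE eqxx.
  by rewrite inE => /orP[/eqP ->|/qmax zq] //; exact: le_trans zq qr.
exists r; split=> [||z]; [exact: rsr|by rewrite root_prod_XsubC|].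
by rewrite root_prod_XsubC; exact: rmax.
Qed.

Hypothesis archi : forall a : C, 0 <= a -> exists n, a < n%:R.
Variables (gT : finGroupType) (m n : nat) (V : gT -> 'M[C]_m).
Hypothesis V1 : V 1%g = 1%:M.
Hypothesis VM : forall x y, V (x * y)%g = V x *m V y.

Let T := [set x | (\rank (V x - 1%:M)%R <= 1)%N].
Hypothesis genT : <<T>>%g = [set: gT].

Variables (J : 'M[C]_n) (L : 'M[C]_(m, n)).
Hypothesis pJ : posdef J.

Definition act (B : 'M[C]_m) x := (V x)^h *m B *m V x.

Definition act_char_poly (B : 'M[C]_m) x : {poly C} :=
  char_poly (invmx J *m (L^h *m act B x *m L)).

Local Notation P := act_char_poly.

Lemma actM B x y : act (act B x) y = act B (x * y)%g.
Proof. by rewrite /act VM ctmxM !mulmxA. Qed.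

Lemma act1 B : act B 1%g = B.
Proof. by rewrite /act V1 mulmx1 ctmx_scalar rmorph1 mul1mx. Qed.

Lemma actN B x : act (- B) x = - act B x.
Proof. by rewrite /act mulmxN mulNmx. Qed.

Lemma act_selfadjoint B x : selfadjoint B -> selfadjoint (act B x).
Proof. exact: selfadjoint_congr. Qed.

Lemma act_char_polyM B x y : P (act B x) y = P B (x * y)%g.
Proof. by rewrite /act_char_poly actM. Qed.

Lemma act_char_poly1 B : P B 1%g = char_poly (invmx J *m (L^h *m B *m L)).
Proof. by rewrite /act_char_poly act1. Qed.

Lemma act_char_poly_deg B x : monic_deg n (P B x).
Proof. by split; [exact: char_poly_monic|exact: size_char_poly]. Qed.

Lemma act_char_polyN B x z : (P (- B) x).[- z] = (-1) ^+ n * (P B x).[z].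
Proof.
rewrite /act_char_poly actN !horner_char_poly -detZ; congr (\det _).
rewrite !(mulmxN, mulNmx) opprK scaleN1r opprB addrC; congr (_ + _).
by apply/matrixP => i j; rewrite !mxE mulNrn.
Qed.

Lemma rotating_act (F : 'M[C]_m -> C) t (a b : C) : rotating F -> t \in T ->
  0 <= a -> 0 <= b -> 0 < a + b -> rotating (fun B => a * F B + b * F (act B t)).
Proof. by rewrite inE; exact: rotating_convex. Qed.

(* Otherwise unification unfolds the congruences down to matrix entries. *)
Local Opaque act act_char_poly.

Lemma walk_deg s B x : monic_deg n (walk s (P B) x).
Proof.
elim: s x => [|t s IH] x /=; first exact: act_char_poly_deg.
rewrite scalerDr; apply: monic_deg_convex => //.
by rewrite [RHS]splitr !mul1r.
Qed.

Lemma walk_act s B x : walk s (P B) x = walk s (P (act B x)) 1%g.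
Proof.
rewrite -[in LHS](mulg1 x); apply: etrans (walk_shift _ _ _ _) _.
by apply: eq_walk => z; rewrite act_char_polyM.
Qed.

Lemma walk_horner s (phi : gT -> {poly C}) x z :
  (walk s phi x).[z] = walk s (fun y => (phi y).[z] : C^o) x.
Proof.
symmetry; apply: (@walk_linear _ _ _ _ (fun p : {poly C} => p.[z] : C^o)).
  by move=> p q; exact: hornerD.
by move=> a p; exact: hornerZ.
Qed.

Lemma walk_horner_scale s (phi psi : gT -> {poly C}) x y z (a : C) :
  (forall u, (phi u).[y] = a * (psi u).[z]) ->
  (walk s phi x).[y] = a * (walk s psi x).[z].
Proof.
move=> h; rewrite (walk_horner s phi) (walk_horner s psi).
apply: etrans (eq_walk (V := C^o) s x h) _.
apply: (@walk_linear _ _ _ _ (fun p : C^o => a * p : C^o)).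
  by move=> p q; exact: mulrDr.
by move=> b p; exact: mulrCA.
Qed.

Definition walk_poly s B := walk s (P B) 1%g.

Lemma walk_poly_cons t s B :
  walk_poly (t :: s) B = 2^-1 *: walk_poly s B + 2^-1 *: walk_poly s (act B t).
Proof.
rewrite /walk_poly -scalerDr.
apply: (congr1 (fun p => 2^-1 *: (_ + p))).
by rewrite mul1g; exact: walk_act.
Qed.

Lemma walk_poly_nil B : walk_poly [::] B = char_poly (invmx J *m (L^h *m B *m L)).
Proof. exact: act_char_poly1. Qed.

Lemma walk_poly_deg s B : monic_deg n (walk_poly s B).
Proof. exact: walk_deg. Qed.

Lemma walk_polyN s B z : (walk_poly s (- B)).[- z] = (-1) ^+ n * (walk_poly s B).[z].
Proof. by apply: walk_horner_scale => y; exact: act_char_polyN. Qed.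

Local Opaque walk_poly.

Lemma rotating_walk s z : all (mem T) s -> 0 < 'Im z ->
  rotating (fun B => (walk_poly s B).[z]).
Proof.
move=> sT z0; elim: s sT => [_|t s IH /= /andP[tT /IH rot]].
  apply: eq_rotating (rotating_det L pJ z0) => B /=.
  by rewrite walk_poly_nil horner_char_poly.
have h0 : 0 < 2^-1 :> C by rewrite invr_gt0 ltr0n.
apply: eq_rotating (rotating_act rot tT (ltW h0) (ltW h0) (addr_gt0 h0 h0)).
by move=> B; rewrite walk_poly_cons horner_lin.
Qed.

Lemma walk_poly_real_roots s B : all (mem T) s -> selfadjoint B ->
  has_real_roots (walk_poly s B).
Proof.
move=> sT; move: B; apply: (@real_roots_of_upper n); last exact: walk_polyN.
by move=> B z hB z0; have [] := rotating_walk sT z0 hB.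
Qed.

Lemma walk_poly_segment_real_roots s t B (a b : C) :
  all (mem T) s -> t \in T -> selfadjoint B -> 0 <= a -> 0 <= b -> a + b = 1 ->
  has_real_roots (a *: walk_poly s B + b *: walk_poly s (act B t)).
Proof.
move=> sT tT hB a0 b0 ab.
have ab0 : 0 < a + b by rewrite ab ltr01.
move: B hB; apply: (@real_roots_of_upper n) => B z.
  move=> hB z0; rewrite horner_lin.
  by have [] := rotating_act (rotating_walk sT z0) tT a0 b0 ab0 hB.
apply: horner_lin_scale; first exact: walk_polyN.
by rewrite actN; exact: walk_polyN.
Qed.

Lemma walk_poly_descent s B c : all (mem T) s -> selfadjoint B -> c \is Num.real ->
  pos_coefs (walk_poly s B \Po ('X + c%:P)) ->
  exists x, pos_coefs (P B x \Po ('X + c%:P)).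
Proof.
move=> + + cr; elim: s B => [|t s IH] B sT hB.
  by rewrite walk_poly_nil -act_char_poly1; exists 1%g.
case/andP: sT => tT sT; rewrite walk_poly_cons comp_poly_lin => pos.
have h0 : 0 <= 2^-1 :> C by rewrite invr_ge0 ler0n.
have half2 : 2^-1 + 2^-1 = 1 :> C by rewrite [RHS]splitr !mul1r.
have deg B' := monic_deg_shift c (walk_poly_deg s B').
have [||] := pos_coefs_convex h0 h0 half2 (deg B) (deg (act B t)) _ pos.
- move=> a b a0 b0 ab; rewrite -comp_poly_lin.
  apply: has_real_roots_shift => //; exact: walk_poly_segment_real_roots.
- exact: IH.
move=> /(IH _ sT (act_selfadjoint _ hB))[x].
by rewrite act_char_polyM => px; exists (t * x)%g.
Qed.

Lemma mean_horner_scale (phi psi : gT -> {poly C}) (a c y z : C) :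
  (forall u, (phi u).[y] = c * (psi u).[z]) ->
  (a *: \sum_u phi u).[y] = c * (a *: \sum_u psi u).[z].
Proof.
move=> h; rewrite !hornerZ !horner_sum mulrCA; congr (_ * _).
by rewrite mulr_sumr; exact: eq_bigr.
Qed.

Definition mean_char_poly B := #|gT|%:R^-1 *: \sum_x P B x.

Lemma mean_deg B : monic_deg n (mean_char_poly B).
Proof.
apply/monic_degP; split.
  rewrite coefZ coef_sum (eq_bigr (fun=> 1)) => [|x _]; last first.
    by have /monic_degP[] := act_char_poly_deg B x.
  rewrite sumr_const mulVf // pnatr_eq0 -lt0n; apply/card_gt0P.
  by exists 1%g.
apply: leq_trans (size_scale_leq _ _) _; apply: leq_trans (size_sum _ _ _) _.
apply/bigmax_leqP => x _.
by have /monic_degP[] := act_char_poly_deg B x.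
Qed.

Lemma mean_real_roots B : selfadjoint B -> has_real_roots (mean_char_poly B).
Proof.
move: B; apply: (@real_roots_of_upper n); last first.
  by move=> B z; apply: mean_horner_scale => x; exact: act_char_polyN.
move=> B z hB z0; apply/eqP => e0.
pose S := \sum_x `|(P B x).[z]|.
have S0 : 0 <= S by apply: sumr_ge0.
pose eta := `|'Im z| ^+ n.
have eta0 : 0 < eta by rewrite exprn_gt0 // normr_gt0 gt_eqF.
have S1 : 0 < 1 + S by rewrite ltr_pwDl.
have [s sT H] := walk_equidistributed genT archi (divr_gt0 eta0 S1).
have le1 := norm_real_rooted z (walk_poly_deg s B) (walk_poly_real_roots sT hB).
have := H (fun x => (P B x).[z]) 1%g; rewrite -walk_horner -horner_sum -hornerZ.
rewrite [X in _ - X]e0 subr0 -/S => /(le_trans le1) le2.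
have : eta / (1 + S) * S < eta by rewrite mulrAC ltr_pdivrMr // ltr_pM2l // ltrDr.
by move=> /lt_geF; rewrite le2.
Qed.

Lemma mean_descent B c : selfadjoint B -> c \is Num.real ->
  pos_coefs (mean_char_poly B \Po ('X + c%:P)) ->
  exists x, pos_coefs (P B x \Po ('X + c%:P)).
Proof.
move=> hB cr pos.
pose phi i x : C^o := (P B x \Po ('X + c%:P))`_i.
have coefE i : (mean_char_poly B \Po ('X + c%:P))`_i = #|gT|%:R^-1 * \sum_x phi i x.
  by rewrite comp_polyZ coefZ rmorph_sum coef_sum.
pose mu i : C := #|gT|%:R^-1 * \sum_x phi i x.
have mu0 (i : 'I_n.+1) : 0 < mu i.
  rewrite /mu -coefE; apply: pos; have [_ ->] := monic_deg_shift c (mean_deg B).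
  exact: ltn_ord.
pose S i := \sum_x `|phi i x|.
have S0 i : 0 <= S i by apply: sumr_ge0.
have r0 (i : 'I_n.+1) : 0 < (1 + S i) / mu i by rewrite divr_gt0 // ltr_pwDl.
pose D := \sum_(i < n.+1) (1 + S i) / mu i.
have D_ge (i : 'I_n.+1) : (1 + S i) / mu i <= D.
  by rewrite /D (bigD1 i) //= lerDl sumr_ge0 // => j _; exact: ltW.
have D0 : 0 < D by apply: lt_le_trans (D_ge ord0).
have Di0 : 0 < D^-1 by rewrite invr_gt0.
have [s sT H] := walk_equidistributed genT archi Di0.
apply: (walk_poly_descent sT hB cr) => i.
have md := monic_deg_shift c (walk_poly_deg s B).
rewrite (proj2 md) => ilt; pose j : 'I_n.+1 := Ordinal ilt.
have rr := real_rooted_coef i md (has_real_roots_shift cr (walk_poly_real_roots sT hB)).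
have wE : (walk_poly s B \Po ('X + c%:P))`_i = walk s (phi i) 1%g.
  symmetry.
  apply: (@walk_linear _ _ _ _ (fun p : {poly C} => (p \Po ('X + c%:P))`_i : C^o)).
    by move=> p q; rewrite comp_polyD coefD.
  by move=> a p; rewrite comp_polyZ coefZ.
have := H (phi i) 1%g; rewrite -wE -/(mu i) -/(S i) => le1.
have lt1 : D^-1 * S i < mu j.
  rewrite mulrC ltr_pdivrMr // mulrC -ltr_pdivrMr //.
  apply: lt_le_trans (D_ge j); rewrite ltr_pM2r ?invr_gt0 //.
  by rewrite ltrDr ltr01.
have := le_lt_trans le1 lt1.
rewrite (real_ltr_distl _ (rpredB rr (gtr0_real (mu0 j)))) subrr.
by case/andP.
Qed.

Theorem mean_largest_root B : (0 < n)%N -> selfadjoint B ->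
  exists x lam mu,
   [/\ lam \is Num.real, mu \is Num.real,
       root (P B x) lam /\ forall z, root (P B x) z -> z <= lam,
       root (mean_char_poly B) mu /\ forall z, root (mean_char_poly B) z -> z <= mu
     & lam <= mu].
Proof.
move=> n0 hB; have nE := prednK n0.
have [mu [mur rmu mumax]] : exists r, [/\ r \is Num.real, root (mean_char_poly B) r
    & forall z, root (mean_char_poly B) z -> z <= r].
  by apply: (@largest_real_root n.-1); rewrite ?nE; [exact: mean_deg|exact: mean_real_roots].
have largest x : exists r, [/\ r \is Num.real, root (P B x) r
    & forall z, root (P B x) z -> z <= r].
  apply: (@largest_real_root n.-1); rewrite ?nE; first exact: act_char_poly_deg.
  rewrite -(mulg1 x) -act_char_polyM act_char_poly1 -walk_poly_nil.
  by apply: walk_poly_real_roots => //; exact: act_selfadjoint.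
have [lam lamP] := fin_all_exists largest.
have lam_real : {in predT, forall x, lam x \is Num.real} by move=> x _; case: (lamP x).
case: (@real_arg_minP _ _ 1%g predT lam isT lam_real) => x _ xmin.
exists x, (lam x), mu; case: (lamP x) => lr rl lmax; split=> //.
rewrite real_leNgt //; apply/negP => lt.
have [|y] := @mean_descent B (lam x) hB lr.
  by apply: (pos_coefs_shift (mean_deg B)) => z /mumax zmu; exact: le_lt_trans lt.
move=> pos; have [_ ry _] := lamP y.
have py0 : P B y != 0 by apply: monic_neq0; case: (act_char_poly_deg B y).
by have := pos_coefs_shift_root py0 pos ry; rewrite xmin.
Qed.

End ReflectionAction.

(** * Coverings as Hermitian forms *)

Section BlockForms.
Variable C : numClosedFieldType.

Lemma ctmx_mxblock p q (p_ : 'I_p -> nat) (q_ : 'I_q -> nat)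
    (A : forall i j, 'M[C]_(p_ i, q_ j)) :
  (\mxblock_(i, j) A i j)^h = \mxblock_(j, i) (A i j)^h.
Proof. by rewrite tr_mxblock; apply/matrixP => i j; rewrite !mxE. Qed.

Lemma ctmx_mxdiag p (p_ : 'I_p -> nat) (A : forall i, 'M[C]_(p_ i)) :
  (\mxdiag_i A i)^h = \mxdiag_i (A i)^h.
Proof.
rewrite /mxdiag ctmx_mxblock; apply/eq_mxblock => i j.
rewrite eq_sym; case: eqVneq => [e|_].
  by case: j / e; rewrite !conform_mx_id.
by apply/matrixP => k l; rewrite !mxE rmorph0.
Qed.

Lemma mul_mxdiag p (p_ : 'I_p -> nat) (A B : forall i, 'M[C]_(p_ i)) :
  \mxdiag_i A i *m \mxdiag_i B i = \mxdiag_i (A i *m B i).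
Proof.
rewrite {2}/mxdiag mul_mxdiag_mxblock; apply/eq_mxblock => i j.
case: eqVneq => [e|_]; last by rewrite mulmx0.
by case: j / e; rewrite !conform_mx_id.
Qed.

Lemma posdef_mxdiag p d (H : 'M[C]_d) : posdef H -> posdef (\mxdiag_(i < p) H).
Proof.
move=> [hH posH]; split.
  by rewrite /selfadjoint ctmx_mxdiag; apply: eq_mxdiag => i; exact: hH.
move=> v v0; pose w (i : 'I_p) : 'rV_d := submxrow v i.
have vE : v = \mxrow_i w i by rewrite submxrowK.
have [i wi] : exists i, w i != 0.
  apply/existsP; apply: contraNT v0 => /existsPn w0.
  rewrite vE -(mxrow0 (q_ := fun=> d)); apply/eqP/eq_mxrow => i.
  by apply/eqP; rewrite -[_ == _]negbK w0.
have vhE : v^h = \mxcol_i (w i)^h.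
  by rewrite vE tr_mxrow; apply/matrixP => k l; rewrite !mxE.
rewrite {1}vE mul_mxrow_mxdiag vhE mul_mxrow_mxcol summxE (bigD1 i) //=.
rewrite ltr_wpDr ?posH // sumr_ge0 // => j _.
by have [->|/posH/ltW//] := eqVneq (w j) 0; rewrite !mul0mx mxE.
Qed.

End BlockForms.

Section LabelGroup.
Variables (I : finType) (gT : finGroupType).
Notation gTn := {dffun forall i : I, gT}.

Lemma gen_dfung1 (S : {set gT}) (T : {set gTn}) : <<S>>%g = [set: gT] ->
  (forall i g, g \in S -> @dfung1 I (fun=> gT) i g \in T) -> <<T>>%g = [set: gTn].
Proof.
move=> Sgen ST; apply/eqP; rewrite eqEsubset subsetT /=; apply/subsetP => x _.
have : x \in setXn (fun _ : I => [set: gT]) by apply/setXnP => i; rewrite inE.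
rewrite -(setXn_prod (fun _ : I => [set: gT]%G)) => /prodsgP[c cP ->].
apply: group_prod => i _; have /set1gXnP[g _ ->] := cP i isT.
have : g \in <<S>>%g by rewrite Sgen inE.
move=> gS; pose f := dfung1_morphism (fun=> gT) i.
have : f g \in (f @* <<S>>)%g by rewrite mem_morphim // inE.
rewrite morphim_gen ?subsetT //; apply/subsetP; apply: genS.
apply/subsetP => _ /morphimP[h _ hS ->]; exact: ST.
Qed.

End LabelGroup.

Section CoveringForm.
Variables (C : numClosedFieldType) (G : multigraph) (o : orientation G).
Variables (gT : finGroupType) (d : nat) (rho : gT -> 'M[C]_d).
Hypothesis rho1 : rho 1%g = 1%:M.
Hypothesis rhoM : forall g h, rho (g * h)%g = rho g *m rho h.

Notation labels := {dffun forall e : edge G, gT}.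
Notation nv := #|vertex G|.
Notation na := #|dart G|.

Definition invariant_form : 'M[C]_d := \sum_g (rho g)^h *m rho g.
Notation H := invariant_form.

Lemma posdef_invariant_form : posdef H.
Proof.
split; first by rewrite /selfadjoint ctmx_sum; apply: eq_bigr => g _; rewrite ctmxM ctmxK.
move=> v v0; rewrite mulmx_sumr mulmx_suml summxE (bigD1 1%g) //=.
have E g : v *m ((rho g)^h *m rho g) *m v^h = (v *m (rho g)^h) *m (v *m (rho g)^h)^h.
  by rewrite [in RHS]ctmxM ctmxK !mulmxA.
rewrite ltr_wpDr ?sumr_ge0 // => [g _|]; first by rewrite E form_sqr_ge0.
by rewrite E rho1 ctmx_scalar rmorph1 mulmx1 form_sqr_gt0.
Qed.

Lemma invariant_formE g : (rho g)^h *m H = H *m rho g^-1%g.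
Proof.
rewrite mulmx_sumr mulmx_suml [RHS](reindex_inj (mulIg g)) /=.
apply: eq_bigr => h _; rewrite -[RHS]mulmxA -rhoM mulgK rhoM ctmxM.
by rewrite !mulmxA.
Qed.

Definition dart_label (k : labels) (a : dart G) : gT :=
  match a with inl e => k e | inr e => (k e)^-1%g end.

(* A labelled edge is split into its two darts: the outgoing dart carries the
   identity and its reverse carries the label, so that labels multiply as
   block diagonal matrices acting by congruence on one fixed Hermitian form. *)
Definition half_label (k : labels) (a : dart G) : 'M[C]_d :=
  match a with inl e => 1%:M | inr e => rho (k e) end.

Definition label_action (k : labels) : 'M[C]_(\sum_(a < na) d) :=
  \mxdiag_(a < na) half_label k (enum_val a).

Definition tail_incidence : 'M[C]_(\sum_(a < na) d, \sum_(u < nv) d) :=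
  \mxblock_(a < na, u < nv)
    ((tail o (enum_val a) == enum_val u)%:R%:M : 'M[C]_d).

Definition reversal_form : 'M[C]_(\sum_(a < na) d) :=
  \mxblock_(a < na, b < na)
    (if enum_val b == dart_rev (enum_val a) then H else 0 : 'M[C]_d).

Definition vertex_form : 'M[C]_(\sum_(u < nv) d) := \mxdiag_(u < nv) H.

Definition label_covering (k : labels) : 'M[C]_(\sum_(u < nv) d) :=
  \mxblock_(u < nv, v < nv)
    \sum_(a : dart G | (tail o a == enum_val u) && (Defs.head o a == enum_val v))
      rho (dart_label k a).

Lemma label_action1 : label_action 1%g = 1%:M.
Proof.
rewrite -mxdiagZ; apply: eq_mxdiag => a.
by case: (enum_val a) => e //=; rewrite oneg_ffun.
Qed.

Lemma label_actionM k l :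
  label_action (k * l)%g = label_action k *m label_action l.
Proof.
rewrite /label_action mul_mxdiag; apply: eq_mxdiag => a.
by case: (enum_val a) => e /=; rewrite ?mulmx1 // mulg_ffun rhoM.
Qed.

Lemma selfadjoint_reversal_form : selfadjoint reversal_form.
Proof.
rewrite /selfadjoint ctmx_mxblock; apply/eq_mxblock => a b.
have -> : (enum_val a == dart_rev (enum_val b)) = (enum_val b == dart_rev (enum_val a)).
  by case: (enum_val a) (enum_val b) => e [f|f] //=; rewrite eq_sym.
case: ifP => _; first exact: (proj1 posdef_invariant_form).
by apply/matrixP => i j; rewrite !mxE rmorph0.
Qed.

Lemma vertex_form_covering k : vertex_form *m label_covering k =
  tail_incidence^h *m ((label_action k)^h *m reversal_form *m label_action k)
    *m tail_incidence.
Proof.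
rewrite /vertex_form mul_mxdiag_mxblock.
rewrite ctmx_mxdiag mul_mxdiag_mxblock mul_mxblock_mxdiag ctmx_mxblock.
rewrite mul_mxblock mul_mxblock; apply/eq_mxblock => u v.
have sumE (F : dart G -> 'M[C]_d) : \sum_(j < na) F (enum_val j) = \sum_a F a.
  by rewrite [RHS](reindex _ (onW_bij _ (enum_val_bij _))).
pose inc (w : vertex G) (a : dart G) : 'M[C]_d := (tail o a == w)%:R%:M.
pose f a b : 'M[C]_d := (inc (enum_val u) a)^h *m ((half_label k a)^h *m
  (if b == dart_rev a then H else 0) *m half_label k b).
transitivity (\sum_b (\sum_a f a b) *m inc (enum_val v) b); last first.
  by rewrite -sumE; apply: eq_bigr => j _; rewrite -sumE.
under [RHS]eq_bigr => b _ do rewrite mulmx_suml.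
rewrite exchange_big /= mulmx_sumr big_mkcond /=; apply: eq_bigr => a _.
rewrite (bigD1 (dart_rev a)) //= big1 => [|b /negPf ba]; last first.
  by rewrite /f ba mulmx0 mul0mx mulmx0 mul0mx.
rewrite addr0 /f eqxx /inc ctmx_scalar rmorph_nat mul_scalar_mx mul_mx_scalar.
have -> : tail o (dart_rev a) = Defs.head o a by case: (a).
have -> : (half_label k a)^h *m H *m half_label k (dart_rev a) = H *m rho (dart_label k a).
  case: (a) => e /=; first by rewrite ctmx_scalar rmorph1 mul1mx.
  by rewrite mulmx1 invariant_formE.
case: eqP => _; case: eqP => _ /=; rewrite ?scale0r ?scaler0 ?scale1r //.
Qed.

Lemma label_action_reflection (e : edge G) g : (\rank (rho g - 1%:M)%R <= 1)%N ->
  (\rank (label_action (@dfung1 _ (fun=> gT) e g) - 1%:M)%R <= 1)%N.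
Proof.
move=> /rank_le1P[c [r crE]].
have -> : label_action (@dfung1 _ (fun=> gT) e g) - 1%:M =
   (\mxcol_(a < na) ((enum_val a == inr e)%:R *: c)) *m
   (\mxrow_(a < na) ((enum_val a == inr e)%:R *: r)).
  rewrite mul_mxcol_mxrow -mxdiagZ -mxdiagB; apply/eq_mxblock => a b.
  case: eqVneq => [ab|ab]; last first.
    have [ea|_] := eqVneq (enum_val a) (inr e); last by rewrite scale0r mul0mx.
    have [eb|_] := eqVneq (enum_val b) (inr e); last by rewrite scale0r mulmx0.
    by case/eqP: ab; apply: enum_val_inj; rewrite ea eb.
  case: b / ab; rewrite conform_mx_id -scalemxAl -scalemxAr scalerA -crE.
  case: (enum_val a) => f /=; first by rewrite subrr mul0r scale0r.
  have [->|fe] := eqVneq f e; first by rewrite eqxx mulr1 scale1r dfung1_id.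
  have ef : e != f by rewrite eq_sym.
  by rewrite (dfung1_dflt _ ef) rho1 subrr (inj_eq inr_inj) (negPf fe) mul0r scale0r.
exact: mulmx_max_rank.
Qed.

Lemma char_poly_label_covering k : char_poly (label_covering k) =
  act_char_poly label_action vertex_form tail_incidence reversal_form k.
Proof.
have Ju : vertex_form \in unitmx.
  exact/posdef_unit/posdef_mxdiag/posdef_invariant_form.
rewrite /act_char_poly /act; congr char_poly.
by rewrite -vertex_form_covering mulKmx.
Qed.

Hypothesis archi : forall a : C, 0 <= a -> exists n, a < n%:R.
Hypothesis gen_reflections :
  <<[set g | (\rank (rho g - 1%:M)%R <= 1)%N]>>%g = [set: gT].

Let gen_label_action :
  <<[set k | (\rank (label_action k - 1%:M)%R <= 1)%N]>>%g = [set: labels].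
Proof.
apply: gen_dfung1 gen_reflections _ => e g; rewrite !inE.
exact: label_action_reflection.
Qed.

Let pJ : posdef vertex_form := posdef_mxdiag nv posdef_invariant_form.

Definition mean_covering_poly : {poly C} :=
  #|labels|%:R^-1 *: \sum_k char_poly (label_covering k).

Lemma mean_covering_polyE : mean_covering_poly =
  mean_char_poly label_action vertex_form tail_incidence reversal_form.
Proof. by congr (_ *: _); apply: eq_bigr => k _; exact: char_poly_label_covering. Qed.

Lemma mean_covering_real_roots : has_real_roots mean_covering_poly.
Proof.
rewrite mean_covering_polyE.
exact: (mean_real_roots archi label_action1 label_actionM gen_label_action pJ
  selfadjoint_reversal_form).
Qed.

Lemma mean_covering_neq0 : mean_covering_poly != 0.
Proof. by rewrite mean_covering_polyE; apply/monic_neq0/(proj1 (mean_deg _ _ _ _)). Qed.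

Lemma mean_covering_largest_root : (0 < nv)%N -> (0 < d)%N ->
  exists k lam mu,
   [/\ lam \is Num.real, mu \is Num.real,
       root (char_poly (label_covering k)) lam /\
         (forall z, root (char_poly (label_covering k)) z -> z <= lam),
       root mean_covering_poly mu /\
         (forall z, root mean_covering_poly z -> z <= mu)
     & lam <= mu].
Proof.
move=> nv0 d0; have n0 : (0 < \sum_(u < nv) d)%N.
  by rewrite sum_nat_const card_ord muln_gt0 nv0.
rewrite mean_covering_polyE.
have [k [lam [mu h]]] := mean_largest_root archi label_action1 label_actionM
  gen_label_action tail_incidence pJ n0 selfadjoint_reversal_form.
by exists k, lam, mu; rewrite char_poly_label_covering.
Qed.

End CoveringForm.

Local Open Scope complex_scope.

Section Labelings.
Variables (G : multigraph) (gT : finGroupType).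

Definition labeling_of (k : {dffun forall e : edge G, gT}) : {ffun dart G -> gT} :=
  [ffun a => dart_label k a].

Lemma labeling_of_inj : injective labeling_of.
Proof.
move=> k l /ffunP e; apply/ffunP => x.
by have := e (inl x); rewrite !ffunE.
Qed.

Lemma labelingsE : labelings G gT = [set labeling_of k | k in setT].
Proof.
apply/setP => gam; rewrite inE; apply/forallP/imsetP => [inv|[k _ ->] a]; last first.
  by rewrite !ffunE; case: a => e /=; rewrite ?invgK.
exists [ffun e => gam (inl e)]; rewrite ?inE //; apply/ffunP => -[] e.
  by rewrite ffunE /= ffunE.
by rewrite ffunE /= ffunE; apply/eqP/(inv (inl e)).
Qed.

Lemma card_labelings : #|labelings G gT| = #|{dffun forall e : edge G, gT}|.
Proof. by rewrite labelingsE card_imset ?cardsT //; exact: labeling_of_inj. Qed.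

End Labelings.

Lemma complex_archimedean (R : realType) (a : R[i]) : 0 <= a ->
  exists n, a < n%:R.
Proof.
move=> a0; exists (Num.bound (complex.Re a)).
rewrite -(RRe_real (ger0_real a0)) -(rmorph_nat (real_complex R)) ltcR.
by apply: archi_boundP; move: a0; rewrite lecE => /andP[].
Qed.

Lemma reflections_generate (R : realType) (gT : finGroupType) (d : nat)
    (rG : mx_representation R[i] [set: gT] d) :
  generated_by_pseudo_reflections (fun A : 'M[R[i]]_d => exists g : gT, A = rG g) ->
  <<[set g | (\rank (rG g - 1%:M)%R <= 1)%N]>>%g = [set: gT].
Proof.
set T := [set g | _]; case=> S Srefl HS.
have lift A : Defs.generated S A -> exists2 h, h \in <<T>>%g & A = rG h.
  elim=> {A} [A SA||A B _ [g gS ->] _ [h hS ->]|A _ [g gT' ->]].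
  - have /HS[g AE] : Defs.generated S A by exact: generated_in.
    exists g => //; apply: mem_gen; rewrite inE -AE.
    by have [_ _ ->] := Srefl A SA.
  - by exists 1%g; rewrite ?group1 ?repr_mx1.
  - by exists (g * h)%g; rewrite ?groupM // repr_mxM ?inE.
  - by exists g^-1%g; rewrite ?groupV // repr_mxV ?inE.
apply/eqP; rewrite eqEsubset subsetT; apply/subsetP => g _.
have [h hT e] : exists2 h, h \in <<T>>%g & rG g = rG h by apply/lift/HS; exists g.
rewrite -[g](mulgKV h) groupM //; apply: mem_gen.
rewrite inE repr_mxM ?inE // repr_mxV ?inE // e mulmxV ?subrr ?mxrank0 //.
by apply: repr_mx_unit; rewrite inE.
Qed.

Theorem theorem1p10 (R : realType) (G : multigraph) (o : orientation G)
    (gT : finGroupType) (d : nat)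
    (rG : mx_representation R[i] [set: gT] d)
    (hrefl : generated_by_pseudo_reflections
               (fun A : 'M[R[i]]_d => exists g : gT, A = rG g)) :
  real_rooted (expected_char_poly o rG) /\
  ((0 < #|vertex G|)%N -> (0 < d)%N ->
   exists2 gam : {ffun dart G -> gT}, gam \in labelings G gT &
   exists lam mu : R,
     [/\ is_largest (eigenvalue (covering o rG gam)) lam,
         is_largest (root (expected_char_poly o rG)) mu
       & lam <= mu]).
Proof.
have genT := reflections_generate hrefl.
have rho1 : rG 1%g = 1%:M by exact: repr_mx1.
have rhoM g h : rG (g * h)%g = rG g *m rG h by rewrite repr_mxM ?inE.
pose C : numClosedFieldType := R[i].
have coverE k : covering o rG (labeling_of k) = @label_covering C G o gT d rG k.
  apply/eq_mxblock => u v; apply: eq_bigr => a _; congr (rG _).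
  by rewrite ffunE.
have meanE : expected_char_poly o rG = @mean_covering_poly C G o gT d rG.
  rewrite /expected_char_poly /mean_covering_poly card_labelings labelingsE.
  congr (_ *: _).
  rewrite big_imset /=; last by move=> k l _ _; exact: labeling_of_inj.
  apply: eq_big => [k|k _]; first by rewrite inE.
  by apply: congr1; exact: coverE.
have archi := @complex_archimedean R.
split.
  rewrite meanE; split; first exact: (@mean_covering_neq0 C).
  exact: (@mean_covering_real_roots C).
move=> nv0 d0.
have [k [lam [mu [lamr mur [rlam lmax] [rmu mmax] le]]]] :=
  @mean_covering_largest_root C G o gT d rG rho1 rhoM archi genT nv0 d0.
exists (labeling_of k); first by rewrite labelingsE imset_f ?inE.
exists (complex.Re lam), (complex.Re mu).
have lamE : (complex.Re lam)%:C = lam by exact: RRe_real.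
have muE : (complex.Re mu)%:C = mu by exact: RRe_real.
split; last by rewrite -lecR lamE muE.
  rewrite /is_largest lamE coverE eigenvalue_root_char; split=> // z.
  by rewrite eigenvalue_root_char; exact: lmax.
by rewrite /is_largest muE meanE.
Qed.
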